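(* For every $\gamma\in(0,1]$ and $\alpha\geq\gamma$, the approximation ratio of the greedy algorithm on the class $\tilde{\mathcal{F}}_{\gamma,\alpha}$ of monotone, weakly $\gamma$-$\alpha$-augmentable functions is exactly \[ \frac{\alpha}{\gamma}\cdot\frac{e^{\alpha}}{e^{\alpha}-1}. \]
   Context: All functions are set functions $f\colon 2^{U}\to\mathbb{R}_{\geq0}$ on some finite ground set $U$; $f$ is monotone if $X\subseteq Y$ implies $f(X)\leq f(Y)$. Write $[n]=\{1,\dots,n\}$. For $k$, $S^{*}_{k}\in\arg\max_{X\subseteq U,|X|\leq k}f(X)$. The greedy algorithm produces $x_1,x_2,\dots$ with $x_i\in\arg\max_{x\in U\setminus\{x_1,\dots,x_{i-1}\}} f(\{x_1,\dots,x_{i-1}\}\cup\{x\})$, and $S^{G}_i=\{x_1,\dots,x_i\}$, $S^{G}_0=\emptyset$; ties are broken by some rule, and each function is considered together with a fixed such greedy run, to which all notions referring to greedy sets refer. $\bar{k}\in[|U|]$ is the smallest index such that $f(S^{G}_{\bar k}\cup\{x\})=f(S^{G}_{\bar k})$ for all $x\in U\setminus S^{G}_{\bar k}$. For $\gamma\in(0,1]$, $\alpha\geq\gamma$, $f$ is weakly $\gamma$-$\alpha$-augmentable if for all $X\in\{S^{G}_0,\dots,S^{G}_{\bar k}\}$ and all $Y\subseteq U$ with $Y\nsubseteq X$ there is $y\in Y$ with $f(X\cup\{y\})-f(X)\geq\frac{\gamma f(X\cup Y)-\alpha f(X)}{|Y|}$. $\tilde{\mathcal{F}}_{\gamma,\alpha}$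 is the set of monotone weakly $\gamma$-$\alpha$-augmentable functions (over all finite ground sets, each with its greedy run). The approximation ratio of the greedy algorithm on a class $\mathcal{F}$ is $\sup_{f\in\mathcal{F}}\max_{k\in[|U|]} f(S^{*}_{k})/f(S^{G}_{k})$. *)

(* Defs.v *)
From HB Require Import structures.
From mathcomp Require Import all_boot all_order all_algebra.
From mathcomp Require Import all_classical all_reals all_analysis.

Set Implicit Arguments.
Unset Strict Implicit.
Unset Printing Implicit Defensive.

Import Order.TTheory GRing.Theory Num.Theory.
Local Open Scope ring_scope.

Section GreedyRuns.
Variables (R : realType) (U : finType).
Implicit Types (f : {set U} -> R) (x : #|U|.-tuple U).

(* Indices are shifted by one: tnth x i is the element selected in step i + 1. *)
Definition greedy_set x (i : nat) : {set U} := [set y in take i x].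

Definition is_greedy_run f x : Prop :=
  forall i : 'I_#|U|,
    tnth x i \notin greedy_set x i /\
    forall y : U, y \notin greedy_set x i ->
      f (greedy_set x i :|: [set y]) <= f (greedy_set x i :|: [set tnth x i]).

Definition monotone f : Prop :=
  forall X Y : {set U}, X \subset Y -> f X <= f Y.

Definition optimal_set f (k : nat) : {set U} :=
  [arg max_(X > finset.set0 | (#|X| <= k)%N) f X]%O.

Definition saturated f (X : {set U}) : bool :=
  [forall y, (y \notin X) ==> (f (X :|: [set y]) == f X)].

Lemma greedy_set_full f x : is_greedy_run f x -> greedy_set x #|U| = [set: U]%SET.
Proof.
move=> gx.
have ux : uniq x.
  apply/tuple_uniqP => i j eij; apply/val_inj => /=.
  have aux (a b : 'I_#|U|) : (a < b)%N -> tnth x a <> tnth x b.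
    move=> ltab eab; have [/negP + _] := gx b; apply.
    rewrite -eab inE (tnth_nth (tnth x a)).
    by rewrite -(nth_take _ ltab) mem_nth // size_take size_tuple ltn_ord.
  by case: (ltngtP i j) => // /aux; [move/(_ eij)|move/(_ (esym eij))].
apply/eqP; rewrite eqEcard finset.subsetT cardsT /greedy_set.
by rewrite take_oversize ?size_tuple // cardsE (card_uniqP ux) size_tuple leqnn.
Qed.

Lemma saturated_ex f x : (0 < #|U|)%N -> is_greedy_run f x ->
  exists k : nat, (0 < k <= #|U|)%N && saturated f (greedy_set x k).
Proof.
move=> U0 /greedy_set_full xT; exists #|U|; rewrite U0 leqnn xT /=.
by apply/forallP => y; rewrite finset.in_setT.
Qed.

End GreedyRuns.

(* A nonnegative set function on a nonempty finite ground set, bundled with the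
   greedy run with respect to which greedy sets are taken. *)
Record greedy_instance (R : realType) := GreedyInstance {
  ground : finType;
  ground_gt0 : (0 < #|ground|)%N;
  objective : {set ground} -> R;
  objective_ge0 : forall X, 0 <= objective X;
  run : #|ground|.-tuple ground;
  run_greedy : is_greedy_run objective run
}.

Section GreedyInstances.
Variable R : realType.
Implicit Types I : greedy_instance R.

Definition kbar I : nat :=
  ex_minn (saturated_ex (ground_gt0 I) (@run_greedy _ I)).

Definition weakly_augmentable (gamma alpha : R) I : Prop :=
  let f := @objective _ I in
  forall i : nat, (i <= kbar I)%N ->
  let X := greedy_set (run I) i in
  forall Y : {set ground I}, ~~ (Y \subset X) ->
  exists2 y, y \in Y &
    f (X :|: [set y]) - f X >= (gamma * f (X :|: Y) - alpha * f X) / #|Y|%:R.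

(* Classes of instances are Prop-valued predicates rather than classical sets:
   greedy_instance quantifies over all finTypes and is too large for set. *)
Definition weakly_augmentable_class (gamma alpha : R) : greedy_instance R -> Prop :=
  fun I => monotone (@objective _ I) /\ weakly_augmentable gamma alpha I.

(* In the extended reals, c / 0 = +oo for c > 0 and 0 / 0 = 0. *)
Definition greedy_ratio I (k : nat) : \bar R :=
  ((@objective _ I (optimal_set (@objective _ I) k))%:E
   / (@objective _ I (greedy_set (run I) k))%:E)%E.

Definition approximation_ratio (F : greedy_instance R -> Prop) : \bar R :=
  ereal_sup [set r | exists2 I, F I &
    r = \big[maxe/-oo%E]_(1 <= k < #|ground I|.+1) greedy_ratio I k]%classic.

End GreedyInstances.

(* Main.v *)
Require Import Defs.
From HB Require Import structures.
From mathcomp Require Import all_boot all_order all_algebra.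
From mathcomp Require Import all_classical all_reals all_analysis.
From mathcomp Require Import ring lra zify.
Import Order.TTheory GRing.Theory Num.Theory.
Import numFieldNormedType.Exports.
Local Open Scope ring_scope.

(* Upper bound: put d_i = gamma f(S*_k) - alpha f(S^G_i). Augmenting S^G_i by S*_k
   gives d_{i+1} <= (1 - alpha/k) d_i <= e^{-alpha/k} d_i as long as d_i > 0, and d
   never becomes positive again, so that d_k <= e^{-alpha} gamma f(S*_k).

   Lower bound: let the ground set consist of N decoys and an optimum of k
   elements, and put q = 1 - alpha/k. A set containing the whole optimum has value
   (alpha/gamma)(1 - q^N); otherwise the optimum elements of a set together count as
   just one more decoy, and a set with i decoys so counted has value
   1 - q^min(i, N). Greedy may collect all decoys first, so its ratio at k is
   (alpha/gamma)(1 - q^N)/(1 - q^k), which for N = k^2 tends to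
   (alpha/gamma)/(1 - e^{-alpha}). The value of the optimum is calibrated so that the
   set of all decoys is just good enough to be augmentable without any gain. *)

(** * Elementary facts on greedy sets and optima *)

Lemma greedy_setS {U : finType} (x : #|U|.-tuple U) (i : 'I_#|U|) :
  greedy_set x i.+1 = (greedy_set x i :|: [set tnth x i])%SET.
Proof.
apply/setP => y; rewrite !inE (take_nth (tnth x i)) ?size_tuple//.
by rewrite mem_rcons inE orbC -tnth_nth.
Qed.

Lemma greedy_set_subset {U : finType} (x : #|U|.-tuple U) (i j : nat) :
  (i <= j)%N -> greedy_set x i \subset greedy_set x j.
Proof.
move=> ij; apply/fintype.subsetP => y; rewrite !inE.
by rewrite -(subnKC ij) takeD mem_cat => ->.
Qed.

Lemma optimal_setP {R : realType} {U : finType} (f : {set U} -> R) (k : nat) :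
  (#|optimal_set f k| <= k)%N /\
  forall X : {set U}, (#|X| <= k)%N -> f X <= f (optimal_set f k).
Proof.
rewrite /optimal_set; case: arg_maxP; first by rewrite finset.cards0.
by move=> X Xk maxX; split=> // Y; apply: maxX.
Qed.

Lemma subr1_expRN_gt0 {R : realType} (alpha : R) :
  0 < alpha -> 0 < 1 - expR (- alpha).
Proof. by move=> a0; rewrite subr_gt0 expR_lt1 oppr_lt0. Qed.

(** * Upper bound for an arbitrary instance *)

Section UpperBound.
Context {R : realType} {gamma alpha : R} {I : greedy_instance R}.
Hypotheses (gamma_gt0 : 0 < gamma) (le_gamma_alpha : gamma <= alpha).
Hypothesis augI : weakly_augmentable_class gamma alpha I.

Let f := @objective _ I.
Let G := greedy_set (run I).

Let alpha_gt0 : 0 < alpha. Proof. exact: lt_le_trans le_gamma_alpha. Qed.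

(** The greedy pick gains at least as much as the element that augmentability provides; as this gain
    is nonnegative, the factor [#|Y|] may be enlarged to [k]. If [Y] lies in [G i] or [i] exceeds
    [kbar], the left side is at most 0. *)
Lemma greedy_gain (Y : {set ground I}) (k i : nat) :
    (#|Y| <= k)%N -> (i < #|ground I|)%N ->
  gamma * f Y - alpha * f (G i) <= k%:R * (f (G i.+1) - f (G i)).
Proof.
have [fmono faug] := augI.
move=> Yk iU; set d := f (G i.+1) - f (G i).
have d0 : 0 <= d by rewrite subr_ge0; apply/fmono/greedy_set_subset.
have [sYG|nsYG] := boolP (Y \subset G i).
  apply: (@le_trans _ _ 0); last by rewrite mulr_ge0.
  rewrite subr_le0; apply: ler_pM => //; first exact: ltW.
    exact: objective_ge0.
  exact: fmono.
have fYU : f Y <= f (G i :|: Y)%SET by apply/fmono/finset.subsetUr.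
have [ik|ki] := leqP i (kbar I).
  have [y yY] := faug _ ik _ nsYG.
  have cY : 0 < #|Y|%:R :> R by rewrite ltr0n card_gt0; apply/set0Pn; exists y.
  rewrite ler_pdivrMr// => aug.
  have gain : f (G i :|: [set y])%SET - f (G i) <= d.
    have [yG|yG] := boolP (y \in G i).
      by rewrite (finset.setUidPl _) ?subrr// finset.sub1set.
    have [_ maxg] := @run_greedy _ I (Ordinal iU).
    by rewrite lerD2r /G (greedy_setS (run I) (Ordinal iU)); apply: maxg.
  apply: (@le_trans _ _ (d * #|Y|%:R)); last first.
    by rewrite mulrC ler_wpM2r// ler_nat.
  apply: le_trans (le_trans aug _); last by rewrite ler_wpM2r// ltW.
  by rewrite lerB// ler_wpM2l// ltW.
(* Beyond [kbar], augmentability is applied at the saturated set [G (kbar I)] instead. No element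
   gains there, so the left side is nonpositive for that set, and monotonicity carries this over to
   [G i]. *)
apply: (@le_trans _ _ 0); last by rewrite mulr_ge0.
have sat : saturated f (G (kbar I)).
  by rewrite /kbar; case: ex_minnP => n /andP[_].
have sG : G (kbar I) \subset G i by apply/greedy_set_subset/ltnW.
have nsY : ~~ (Y \subset G (kbar I)).
  by apply: contra nsYG => /fintype.subset_trans; apply.
have [y yY] := faug _ (leqnn _) _ nsY.
have cY : 0 < #|Y|%:R :> R by rewrite ltr0n card_gt0; apply/set0Pn; exists y.
have fy : f (G (kbar I) :|: [set y])%SET = f (G (kbar I)).
  have [yG|yG] := boolP (y \in G (kbar I)).
    by rewrite (finset.setUidPl _)// finset.sub1set.
  by have /forallP/(_ y)/implyP/(_ yG)/eqP := sat.
rewrite -/f -/G fy subrr ler_pdivrMr// mul0r => aug.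
apply: le_trans aug; apply: lerB.
  by apply: ler_wpM2l; [exact: ltW|apply/fmono/finset.subsetUr].
by apply: ler_wpM2l; [exact: ltW|exact: fmono].
Qed.

(** The decay factor is e^{-alpha/k} rather than 1 - alpha/k: the latter may be negative for small
    [k] and could then not multiply the induction hypothesis. *)
Lemma greedy_gap (Y : {set ground I}) (k i : nat) :
    (0 < k)%N -> (#|Y| <= k)%N -> (i <= #|ground I|)%N ->
  gamma * f Y - alpha * f (G i) <= expR (- (alpha / k%:R)) ^+ i * (gamma * f Y).
Proof.
move=> k0 Yk; have fY0 : 0 <= gamma * f Y.
  by rewrite mulr_ge0 ?objective_ge0// ltW.
have k0R : 0 < k%:R :> R by rewrite ltr0n.
elim: i => [|i IH] iU.
  by rewrite expr0 mul1r gerBl mulr_ge0 ?objective_ge0// ltW.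
set D := gamma * f Y - alpha * f (G i).
have [D0|D0] := leP D 0.
  apply: (@le_trans _ _ 0); last by rewrite mulr_ge0// exprn_ge0// expR_ge0.
  apply: le_trans D0; rewrite lerB//; apply: ler_wpM2l; first exact: ltW.
  by have [fmono _] := augI; apply/fmono/greedy_set_subset.
rewrite exprS -mulrA.
apply: (@le_trans _ _ (expR (- (alpha / k%:R)) * D)); last first.
  by rewrite ler_wpM2l ?expR_ge0// IH// ltnW.
apply: (@le_trans _ _ ((1 + - (alpha / k%:R)) * D)); last first.
  by rewrite ler_wpM2r ?expR_ge1Dx// ltW.
have gain : D / k%:R <= f (G i.+1) - f (G i).
  by rewrite ler_pdivrMr// mulrC [leRHS]mulrC mulrC greedy_gain.
have := ler_wpM2l (ltW alpha_gt0) gain.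
rewrite /D; lra.
Qed.

Lemma greedy_bound (Y : {set ground I}) (k : nat) :
    (0 < k <= #|ground I|)%N -> (#|Y| <= k)%N ->
  gamma * f Y * (1 - expR (- alpha)) <= alpha * f (G k).
Proof.
move=> /andP[k0 kU] Yk; have := @greedy_gap Y k k k0 Yk kU.
rewrite -expRM_natl mulrN mulrC [_ * (_ / _)]mulrC divfK ?pnatr_eq0 -?lt0n//.
lra.
Qed.

Lemma greedy_ratio_le (k : nat) : (0 < k <= #|ground I|)%N ->
  (greedy_ratio I k <= (alpha / gamma / (1 - expR (- alpha)))%:E)%E.
Proof.
move=> kI; have [optk _] := optimal_setP f k.
have := greedy_bound _ _ kI optk; rewrite /greedy_ratio -/f -/G => bound.
have e0 := subr1_expRN_gt0 _ alpha_gt0.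
have Gge0 : 0 <= f (G k) by exact: objective_ge0.
have Oge0 : 0 <= f (optimal_set f k) by exact: objective_ge0.
(* A zero greedy value forces a zero optimum through [bound], and the ratio is then 0 / 0 = 0. *)
move: Gge0; rewrite le_eqVlt => /predU1P[G0|G0].
  have -> : f (optimal_set f k) = 0.
    apply/eqP; rewrite eq_le Oge0 andbT.
    move: bound; rewrite -G0 mulr0 pmulr_lle0// pmulr_rle0//.
  by rewrite -G0 mul0e lee_fin divr_ge0 ?divr_ge0 ?ltW.
rewrite inver gt_eqF// -EFinM lee_fin ler_pdivrMr//.
rewrite mulrAC ler_pdivlMr// mulrAC ler_pdivlMr//.
by move: bound; rewrite -mulrA mulrC.
Qed.

End UpperBound.

(** * Estimates of (1 - alpha/k)^k and passage to the limit *)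

Lemma expR_le_expr_1B {R : realType} (alpha : R) (k : nat) :
  0 <= alpha -> alpha < k%:R ->
  expR (- (alpha / (1 - alpha / k%:R))) <= (1 - alpha / k%:R) ^+ k.
Proof.
move=> a0 ak; have k0 : 0 < k%:R :> R by apply: le_lt_trans ak.
set x := alpha / k%:R.
have x1 : 0 < 1 - x by rewrite subr_gt0 ltr_pdivrMr ?mul1r.
have -> : alpha / (1 - x) = k%:R * (x / (1 - x)).
  by rewrite mulrA /x [k%:R * _]mulrC divfK ?gt_eqF.
rewrite -mulrN expRM_natl lerXn2r ?nnegrE ?expR_ge0 ?(ltW x1)//.
rewrite expRN -[leRHS]invrK lef_pV2 ?posrE ?expR_gt0 ?invr_gt0//.
(* What remains is 1/(1 - x) = 1 + x/(1 - x) <= e^{x/(1 - x)}. *)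
apply: le_trans (expR_ge1Dx _).
rewrite -[X in X <= _]mul1r ler_pdivrMr// mulrDl mul1r divfK ?gt_eqF//; lra.
Qed.

(** Needed for n = 1, where it makes 1 - (1 - alpha/k)^k positive, and for n = k, where the bound
    tends to 0. *)
Lemma expr_1B_le_expR {R : realType} (alpha : R) (k n : nat) :
  0 <= alpha -> alpha < k%:R ->
  (1 - alpha / k%:R) ^+ (k * n) <= expR (- alpha) ^+ n.
Proof.
move=> a0 ak; have k0 : 0 < k%:R :> R by apply: le_lt_trans ak.
have x1 : 0 <= 1 - alpha / k%:R by rewrite subr_ge0 ler_pdivrMr ?mul1r// ltW.
rewrite exprM lerXn2r ?nnegrE ?exprn_ge0 ?expR_ge0//.
have -> : - alpha = k%:R * (- (alpha / k%:R)).
  by rewrite mulrN mulrC divfK ?gt_eqF.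
by rewrite expRM_natl lerXn2r ?nnegrE ?expR_ge0 ?expR_ge1Dx.
Qed.

(** Here [c] stands for alpha/gamma and [m] for the approximation ratio. The two preceding estimates
    replace both sides of the hypothesis by exponentials with known limits. *)
Lemma geometric_ratio_limit {R : realType} (alpha c m : R) :
  0 < alpha -> 0 <= c ->
  (forall k : nat, (1 < k)%N -> alpha < k%:R ->
    c * (1 - (1 - alpha / k%:R) ^+ (k * k))
    <= m * (1 - (1 - alpha / k%:R) ^+ k)) ->
  c <= m * (1 - expR (- alpha)).
Proof.
move=> a0 c0 ratio.
(* The index is shifted to k = n + 1, so that alpha/k is [alpha * harmonic n]. *)
have h0 : (alpha * harmonic n @[n --> \oo] --> 0)%classic.
  by rewrite -(mulr0 alpha); apply: cvgMr; apply: cvg_harmonic.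
have lhs : (c * (1 - expR (- alpha) ^+ n.+1) @[n --> \oo] --> c * (1 - 0))%classic.
  apply: cvgMr; apply: cvgB; first exact: cvg_cst.
  rewrite (cvg_shiftS (fun n => expR (- alpha) ^+ n)).
  by apply: cvg_expr; rewrite ger0_norm ?expR_ge0// expR_lt1 oppr_lt0.
have rhs : (m * (1 - expR (- (alpha / (1 - alpha * harmonic n))))
    @[n --> \oo] --> m * (1 - expR (- alpha)))%classic.
  apply: cvgMr; apply: cvgB; first exact: cvg_cst.
  apply: continuous_cvg; first exact: continuous_expR.
  apply: cvgN; rewrite -[X in (_ --> X)%classic]mulr1.
  apply: cvgMr; rewrite -[X in (_ --> X)%classic]invr1; apply: cvgV => //.
  by rewrite -[X in (_ --> X)%classic]subr0; apply: cvgB => //; apply: cvg_cst.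
rewrite subr0 mulr1 in lhs; apply: ler_cvg_to lhs rhs _.
near=> n.
have nl1 : (1 < n.+1)%N.
  by rewrite ltnS; near: n; exact: nbhs_infty_gt.
have an : alpha < n.+1%:R.
  rewrite (@lt_trans _ _ n%:R) ?ltr_nat//; near: n; exact: nbhs_infty_gtr.
have a1 := ltW a0.
have q1 : (1 - alpha / n.+1%:R) ^+ n.+1 < 1.
  have := @expr_1B_le_expR _ _ _ 1 a1 an; rewrite muln1 expr1.
  by move/le_lt_trans; apply; rewrite expR_lt1 oppr_lt0.
have R1 := ratio _ nl1 an.
(* The sign of [m] is read off the hypothesis; it allows multiplying the estimate of 1 - (1 -
   alpha/k)^k by [m]. *)
have m0 : 0 <= m.
  rewrite -(pmulr_lge0 m (x := 1 - (1 - alpha / n.+1%:R) ^+ n.+1)) ?subr_gt0//.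
  apply: le_trans R1; rewrite mulr_ge0// subr_ge0.
  rewrite (le_trans (expr_1B_le_expR _ _ _ a1 an))// exprn_ile1 ?expR_ge0//.
  by rewrite expR_le1 oppr_le0.
apply: (le_trans (y := c * (1 - (1 - alpha / n.+1%:R) ^+ (n.+1 * n.+1)))).
  by rewrite ler_wpM2l// lerB// expr_1B_le_expR.
apply: le_trans R1 _; rewrite ler_wpM2l// lerB//.
exact: expR_le_expr_1B.
Unshelve. all: by end_near.
Qed.

(** * Runs in the enumeration order of an ordinal type *)

Section IdentityRun.
Context {n : nat}.

Definition initial (t : nat) : {set 'I_n} := [set y : 'I_n | (y < t)%N].

Lemma greedy_set_enum (t : nat) : greedy_set (enum_tuple 'I_n) t = initial t.
Proof.
by apply/setP => y; rewrite !inE in_take ?mem_enum//= index_enum_ord.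
Qed.

Lemma card_initial (t : nat) : (t <= n)%N -> #|initial t| = t.
Proof.
move=> tn; have winj : injective (widen_ord tn).
  by move=> a b /(congr1 val) /= /val_inj.
rewrite -[RHS](card_ord t) -(card_imset _ winj).
apply: eq_card => y; rewrite inE; apply/idP/imsetP => [yt|[z _ ->]]; last first.
  exact: ltn_ord z.
by exists (Ordinal yt) => //; apply: val_inj.
Qed.

Lemma tnth_enum (i : 'I_#|'I_n|) : tnth (enum_tuple 'I_n) i = i :> nat.
Proof.
have lt_in : (i < n)%N by rewrite -[X in (_ < X)%N]card_ord.
by rewrite (tnth_nth (Ordinal lt_in)) nth_enum_ord.
Qed.

End IdentityRun.

(** * Lower bound: the hard instance, with the decoys as its first [N] indices *)

Section HardInstance.
Context {R : realType} {gamma alpha : R} {k N : nat}.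
Hypotheses (gamma_gt0 : 0 < gamma) (le_gamma_alpha : gamma <= alpha).
Hypotheses (k_gt1 : (1 < k)%N) (alpha_lt_k : alpha < k%:R).

Local Notation U := 'I_(N + k).
Let q : R := 1 - alpha / k%:R.

Let alpha_gt0 : 0 < alpha. Proof. exact: lt_le_trans le_gamma_alpha. Qed.

Let k_gt0 : 0 < k%:R :> R. Proof. by rewrite ltr0n ltnW. Qed.

Let q_ge0 : 0 <= q.
Proof. by rewrite subr_ge0 ler_pdivrMr// mul1r ltW. Qed.

Let q_lt1 : q < 1. Proof. by rewrite gtrBl divr_gt0. Qed.

Definition decoys : {set U} := initial N.

Lemma card_decoysC : #|~: decoys| = k.
Proof.
by rewrite cardsCs finset.setCK card_initial ?leq_addr// card_ord addKn.
Qed.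

(** Once all decoys are in, the cap at [N] prevents any growth until the optimum is complete. *)
Definition level (S : {set U}) : nat :=
  minn N (#|S :&: decoys| + ~~ (S \subset decoys)).

Definition hard (S : {set U}) : R :=
  if ~: decoys \subset S then alpha / gamma * (1 - q ^+ N)
  else 1 - q ^+ level S.

Lemma level_subset (X Y : {set U}) : X \subset Y -> (level X <= level Y)%N.
Proof.
move=> XY; rewrite leq_min geq_minl /=.
apply: leq_trans (geq_minr _ _) _; apply: leq_add.
  by apply/subset_leq_card/finset.setSI.
case: (boolP (Y \subset decoys)) => YA; last by rewrite leq_b1.
by rewrite (fintype.subset_trans XY YA).
Qed.

Lemma level_card (X : {set U}) : (level X <= #|X|)%N.
Proof.
apply: leq_trans (geq_minr _ _) _.
rewrite -[leqRHS](cardsID decoys X) leq_add2l -finset.setD_eq0 -card_gt0.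
by case: #|_|.
Qed.

(** Inside [decoys], the set has more than [t] elements; otherwise its optimum elements add one to
    the [t] decoys. So every new element raises the level while decoys remain. *)
Lemma ltn_level (t : nat) (S : {set U}) :
  initial t \subset S -> (t < N)%N -> ~~ (S \subset initial t) -> (t < level S)%N.
Proof.
move=> tS tN /fintype.subsetPn[y yS yt]; rewrite leq_min tN /=.
have tA : initial t \subset decoys.
  by apply/fintype.subsetP => z; rewrite !inE => /ltn_trans; apply.
have ct : #|@initial (N + k) t| = t by rewrite card_initial// ltnW// ltn_addr.
have tSA : initial t \subset S :&: decoys by rewrite finset.subsetI tS.
have [SA|_] := boolP (S \subset decoys); last first.
  by rewrite addn1 ltnS -{1}ct subset_leq_card.
rewrite addn0 (finset.setIidPl SA) -{1}ct; apply: proper_card.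
by apply/fintype.properP; split=> //; exists y.
Qed.

Lemma level_full (S : {set U}) : decoys \subset S -> level S = N.
Proof.
move=> AS; apply/minn_idPl.
by rewrite (finset.setIidPr AS) card_initial ?leq_addr.
Qed.

Let pow_le (m n : nat) : (m <= n)%N -> q ^+ n <= q ^+ m.
Proof. by move=> mn; apply: ler_wiXn2l => //; exact: ltW. Qed.

Let pow_le1 (n : nat) : q ^+ n <= 1.
Proof. by rewrite exprn_ile1// ltW. Qed.

Lemma hard_top : 1 - q ^+ N <= alpha / gamma * (1 - q ^+ N).
Proof. by rewrite ler_peMl ?subr_ge0// ler_pdivlMr// mul1r. Qed.

(** Valid in both branches of [hard], this spares lower estimates the question whether the optimum
    is complete. *)
Lemma hard_ge_level (S : {set U}) : 1 - q ^+ level S <= hard S.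
Proof.
rewrite /hard; case: ifP => // _; apply: le_trans hard_top.
by rewrite lerB// pow_le// geq_minl.
Qed.

Lemma hard_le_top (S : {set U}) : hard S <= alpha / gamma * (1 - q ^+ N).
Proof.
rewrite /hard; case: ifP => // _; apply: le_trans hard_top.
by rewrite lerB// pow_le// geq_minl.
Qed.

Lemma hard_ge0 (S : {set U}) : 0 <= hard S.
Proof. by apply: le_trans (hard_ge_level S); rewrite subr_ge0. Qed.

Lemma hard_monotone : Defs.monotone hard.
Proof.
move=> X Y XY; rewrite [leLHS]/hard; case: ifPn => BX.
  by rewrite /hard (fintype.subset_trans BX XY).
by apply: le_trans (hard_ge_level Y); rewrite lerB// pow_le// level_subset.
Qed.

Lemma hard_initial (t : nat) : (t <= N)%N -> hard (initial t) = 1 - q ^+ t.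
Proof.
(* The last index is an optimum element outside [initial t], which excludes the first branch of
   [hard]. *)
move=> tN; have lt_last : ((N + k).-1 < N + k)%N by lia.
rewrite /hard ifF; last first.
  apply/negP => /fintype.subsetP/(_ (Ordinal lt_last)); rewrite !inE /=; lia.
congr (1 - q ^+ _); apply/eqP; rewrite eqn_leq; apply/andP; split.
  by apply: leq_trans (level_card _) _; rewrite card_initial//; lia.
have tA : initial t \subset decoys.
  by apply/fintype.subsetP => z; rewrite !inE => /leq_trans; apply.
rewrite leq_min tN /= (finset.setIidPl tA) card_initial ?leq_addr//; lia.
Qed.

(* With at least two elements of the optimum still missing, a single insertion
   cannot complete it; if only one is missing, it is the only choice left. *)
Lemma hard_run : is_greedy_run hard (enum_tuple U).
Proof.
move=> i; have jE := tnth_enum i; move: (tnth _ i) jE => j jE.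
have lt_iU : (i < N + k)%N by rewrite -[X in (_ < X)%N]card_ord.
move: (nat_of_ord i) jE lt_iU => t jE lt_tU; rewrite greedy_set_enum.
have j_notin : j \notin initial t by rewrite inE jE ltnn.
split=> // y y_notin.
have ty : (t <= y)%N by move: y_notin; rewrite inE -leqNgt.
have lt_yU : (y < N + k)%N := ltn_ord y.
have [last_t|not_last] := eqVneq t.+1 (N + k)%N.
  have -> // : y = j.
  by apply: val_inj; rewrite /= jE; lia.
apply: le_trans (hard_ge_level _).
rewrite /hard ifF.
  rewrite lerB// pow_le//.
  (* While decoys remain, [y] leads to level at most t + 1, which [j] reaches; afterwards [j]
     already attains the cap [N]. *)
  have [tN|Nt] := ltnP t N; last first.
    rewrite [leqRHS]level_full ?geq_minl//.
    apply/fintype.subsetP => z; rewrite !inE => zN.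
    by rewrite (leq_trans zN).
  apply: leq_trans (level_card _) _; rewrite finset.setUC cardsU1 y_notin.
  rewrite card_initial; last by lia.
  rewrite add1n; apply: ltn_level => //; first exact: finset.subsetUl.
  by apply/fintype.subsetPn; exists j; rewrite // !inE eqxx orbT.
(* As [1 < k], the last two indices both belong to the optimum. Neither is in [initial t], and [y]
   cannot equal both. *)
have lt1 : ((N + k).-1 < N + k)%N by lia.
have lt2 : ((N + k).-2 < N + k)%N by lia.
apply/negP => /fintype.subsetP sub.
have := sub (Ordinal lt1); have := sub (Ordinal lt2).
rewrite !inE -!val_eqE /=; lia.
Qed.

Lemma hard_ground_gt0 : (0 < #|U|)%N.
Proof. by rewrite card_ord; lia. Qed.

Definition hard_instance : greedy_instance R :=
  GreedyInstance hard_ground_gt0 hard_ge0 hard_run.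

(** The optimum has [k] elements and thus competes for the best set of size [k], while [k <= N]
    makes the first [k] greedy picks decoys. *)
Lemma hard_ratio : (k <= N)%N ->
  ((alpha / gamma * (1 - q ^+ N) / (1 - q ^+ k))%:E
   <= greedy_ratio hard_instance k)%E.
Proof.
move=> kN; suff : ((alpha / gamma * (1 - q ^+ N) / (1 - q ^+ k))%:E
    <= (hard (optimal_set hard k))%:E / (hard (initial k))%:E)%E.
  by rewrite /greedy_ratio [run _]/= greedy_set_enum.
have qk : 0 < 1 - q ^+ k by rewrite subr_gt0 exprn_ilt1//; lia.
rewrite hard_initial// inver gt_eqF// -EFinM lee_fin ler_pM2r ?invr_gt0//.
have [_ /(_ (~: decoys))] := optimal_setP hard k.
by rewrite {1}/hard fintype.subxx card_decoysC; apply.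
Qed.

Hypothesis gamma_le1 : gamma <= 1.

(** Any element of [Y] outside [initial t] works, since while decoys remain all new elements share
    the lower bound q^t alpha/k on their gain. *)
Lemma hard_gain (t : nat) (Y : {set U}) : ~~ (Y \subset initial t) ->
  exists2 y, y \in Y &
    (gamma * hard (initial t :|: Y)%SET - alpha * hard (initial t)) / #|Y|%:R
    <= hard (initial t :|: [set y])%SET - hard (initial t).
Proof.
set X := initial t; move=> /fintype.subsetPn[y yY yX].
exists y => //.
have cY : 0 < #|Y|%:R :> R by rewrite ltr0n card_gt0; apply/set0Pn; exists y.
rewrite ler_pdivrMr//.
(* With all decoys chosen, no gain is required: the top value is (alpha/gamma)(1 - q^N), hence at
   most alpha/gamma times [hard X]. *)
have [Nt|tN] := leqP N t.
  apply: (@le_trans _ _ 0); last first.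
    by rewrite mulr_ge0 ?ler0n// subr_ge0; apply/hard_monotone/finset.subsetUl.
  have topX : 1 - q ^+ N <= hard X.
    apply: le_trans (hard_ge_level X); rewrite level_full//.
    by apply/fintype.subsetP => z; rewrite !inE => /leq_trans; apply.
  rewrite subr_le0 (le_trans (ler_wpM2l (ltW gamma_gt0) (hard_le_top _)))//.
  by rewrite mulrA [gamma * _]mulrC divfK ?gt_eqF// ler_wpM2l// ltW.
have fX : hard X = 1 - q ^+ t by rewrite /X hard_initial// ltnW.
have gain : q ^+ t * (alpha / k%:R) <= hard (X :|: [set y]) - hard X.
  have lev : (t < level (X :|: [set y])%SET)%N.
    apply: ltn_level => //; first exact: finset.subsetUl.
    by apply/fintype.subsetPn; exists y; rewrite // !inE eqxx orbT.
  have := hard_ge_level (X :|: [set y])%SET; have := pow_le _ _ lev.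
  by rewrite fX exprS /q; lra.
apply: le_trans (ler_wpM2r (ler0n _ _) gain).
have qt0 : 0 <= q ^+ t by rewrite exprn_ge0.
rewrite fX [hard _]/hard; case: ifPn => [BXY|_].
  (* [X] has only decoys, so [Y] contains the whole optimum. Hence [#|Y|] times the gain is at least
     alpha q^t, which covers the required alpha (q^t - q^N). *)
  have kY : (k <= #|Y|)%N.
    suff : (#|~: decoys| <= #|Y|)%N by rewrite card_decoysC.
    apply/subset_leq_card/fintype.subsetP => z zB.
    have := fintype.subsetP BXY z zB; rewrite inE => /orP[|//].
    move: zB; rewrite !inE -leqNgt => Nz.
    by rewrite ltnNge (leq_trans (ltnW tN) Nz).
  rewrite mulrA [gamma * _]mulrC divfK ?gt_eqF//.
  have qN0 : 0 <= alpha * q ^+ N by rewrite mulr_ge0 ?exprn_ge0// ltW.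
  have : q ^+ t * (alpha / k%:R) * k%:R <= q ^+ t * (alpha / k%:R) * #|Y|%:R.
    by rewrite ler_wpM2l ?ler_nat// mulr_ge0// divr_ge0// ltW.
  by rewrite -[_ * k%:R]mulrA divfK ?gt_eqF//; lra.
have lev : (level (X :|: Y)%SET <= t + #|Y|)%N.
  apply: leq_trans (level_card _) _; apply: leq_trans (leq_card_setU _ _) _.
  by rewrite card_initial// ltnW// ltn_addr.
(* Bernoulli's inequality for q = 1 - alpha/k. *)
have bern : 1 - q ^+ #|Y| <= #|Y|%:R * (alpha / k%:R).
  elim: #|Y| => [|n IH]; first by rewrite expr0 subrr mul0r.
  have : alpha / k%:R * q ^+ n <= alpha / k%:R.
    by rewrite ler_piMr// divr_ge0// ltW.
  by rewrite exprS -natr1 {2}/q; lra.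
have powY := pow_le _ _ lev; rewrite exprD in powY.
have := pow_le1 t.
set p := q ^+ #|Y| in bern powY; set a := alpha / k%:R in bern *.
set qt := q ^+ t in powY qt0 *; set ql := q ^+ level _ in powY *.
(* Lowering alpha to gamma bounds the left side by gamma q^t (1 - p); then [gamma <= 1] removes
   gamma and [bern] concludes. *)
have b2 : qt * (1 - p) <= qt * (#|Y|%:R * a) by exact: ler_wpM2l.
have p1 : 0 <= qt * (1 - p) by rewrite mulr_ge0// subr_ge0 pow_le1.
have b3 : gamma * (qt * (1 - p)) <= qt * (1 - p) by rewrite ler_piMl.
move=> qt1.
have b4 : gamma * (1 - qt) <= alpha * (1 - qt) by rewrite ler_wpM2r ?subr_ge0.
have b5 : gamma * (1 - ql) <= gamma * (1 - qt * p).
  by rewrite ler_wpM2l ?(ltW gamma_gt0)// lerB.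
lra.
Qed.

Lemma hard_augmentable : weakly_augmentable_class gamma alpha hard_instance.
Proof.
split; first exact: hard_monotone.
by move=> t _; rewrite [run _]/= greedy_set_enum => X Y; exact: hard_gain.
Qed.

End HardInstance.

Theorem theorem6 (R : realType) (gamma alpha : R)
    (gamma_gt0 : 0 < gamma) (gamma_le1 : gamma <= 1) (le_gamma_alpha : gamma <= alpha) :
  approximation_ratio (weakly_augmentable_class gamma alpha)
  = (alpha / gamma * (expR alpha / (expR alpha - 1)))%:E.
Proof.
have alpha_gt0 : 0 < alpha := lt_le_trans gamma_gt0 le_gamma_alpha.
have e0 := subr1_expRN_gt0 _ alpha_gt0.
have -> : expR alpha / (expR alpha - 1) = (1 - expR (- alpha))^-1.
  have ea0 : expR alpha != 0 by rewrite expR_eq0.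
  have ea1 : expR alpha - 1 != 0 by rewrite subr_eq0 gt_eqF// expR_gt1.
  by rewrite expRN; field; rewrite ea0 ea1.
apply/eqP; rewrite eq_le; apply/andP; split.
  apply/ereal_supP => _ [I augI ->]; rewrite big_nat_cond.
  apply: bigmax_le => [|k]; first exact: leNye.
  by rewrite andbT ltnS => kI; exact: greedy_ratio_le.
have ratio_le (k : nat) : (1 < k)%N -> alpha < k%:R ->
    ((alpha / gamma * (1 - (1 - alpha / k%:R) ^+ (k * k))
      / (1 - (1 - alpha / k%:R) ^+ k))%:E
     <= approximation_ratio (weakly_augmentable_class gamma alpha))%E.
  move=> k1 ak; have kN : (k <= k * k)%N by rewrite leq_pmulr// ltnW.
  pose J := @hard_instance R gamma alpha k (k * k)
    gamma_gt0 le_gamma_alpha k1 ak.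
  apply: le_ereal_sup_tmp; eexists.
    exists J; last reflexivity.
    exact: hard_augmentable.
  apply: le_trans (hard_ratio gamma_gt0 le_gamma_alpha k1 ak kN) _.
  apply: le_bigmax_seq => //; rewrite mem_index_iota card_ord; lia.
(* A finite supremum goes into the limit lemma, [+oo] is immediate, and [-oo] is refuted by a single
   hard instance. *)
move: ratio_le; case: (approximation_ratio _) => [m| |] ratio_le.
- rewrite lee_fin ler_pdivrMr//; apply: geometric_ratio_limit => //.
    by rewrite divr_ge0// ltW.
  move=> k k1 ak; have := ratio_le k k1 ak; rewrite lee_fin ler_pdivrMr//.
  rewrite subr_gt0 exprn_ilt1 ?gtrBl ?divr_gt0 ?ltr0n//; try lia.
  by rewrite subr_ge0 ler_pdivrMr ?mul1r ?ltW// ltr0n ltnW.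
- exact: leey.
- have [k ak] : exists k : nat, alpha < k%:R.
    by exists (Num.truncn alpha).+1; rewrite truncnS_gt.
  (* The shift by two ensures that the size exceeds 1. *)
  have ak2 : alpha < k.+2%:R by rewrite (lt_trans ak)// ltr_nat.
  by have := ratio_le k.+2 isT ak2; rewrite leeNy_eq.
Qed.
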